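(* For every $d \geq 1$ and $n \geq 1$ we have $$P_d(n) \geq 2^{\frac{2}{3}\, n^{d}/\sqrt{d+1}} .$$
   Context: All parameters are integers. A $d$-dimensional $n\times\cdots\times n$ partition with entries from $\{0,1,\ldots,n\}$ is a $d$-dimensional (hyper)matrix $A=(A_{i_1,\ldots,i_d})_{1\le i_1,\ldots,i_d\le n}$ with $A_{i_1,\ldots,i_d}\in\{0,1,\ldots,n\}$ that is (weakly) decreasing in each line: $A_{i_1,\ldots,i_t,\ldots,i_d}\ge A_{i_1,\ldots,i_t+1,\ldots,i_d}$ for all $1\le t\le d$ and all indices for which both sides are defined. $P_d(n)$ is the number of such partitions. *)

(* Defs.v *)
From HB Require Import structures.
From mathcomp Require Import all_boot all_order all_algebra.
From mathcomp Require Import all_classical all_reals all_analysis.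

Set Implicit Arguments.
Unset Strict Implicit.
Unset Printing Implicit Defensive.

Local Open Scope nat_scope.

(* Coordinates are numbered from 0: a multi-index (i_1, ..., i_d) with
   1 <= i_t <= n is represented by the function t |-> i_t - 1. *)
Definition multi_index (d n : nat) := {ffun 'I_d -> 'I_n}.

Definition hypermatrix (d n : nat) := {ffun multi_index d n -> 'I_n.+1}.

(* j is i with its t-th coordinate increased by 1; if i_t is already maximal,
   there is no such j. *)
Definition next_along (d n : nat) (t : 'I_d) (i j : multi_index d n) : bool :=
  (j t == (i t).+1 :> nat) && [forall s, (s != t) ==> (j s == i s)].

Definition is_partition (d n : nat) (A : hypermatrix d n) : bool :=
  [forall t : 'I_d, forall i : multi_index d n, forall j : multi_index d n,
     next_along t i j ==> (A j <= A i)].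

Definition num_partitions (d n : nat) : nat :=
  #|[set A : hypermatrix d n | is_partition A]|.

(* Main.v *)
Require Import Defs.
From HB Require Import structures.
From mathcomp Require Import all_boot all_order all_algebra.
From mathcomp Require Import all_classical all_reals all_analysis.
From mathcomp Require Import zify ring lra.

(** Write [|i|] for the sum of the coordinates of a multi-index [i].  Fix a
    level [k] and let [J] be the set of the multi-indices [i] with
    [k - n < |i| <= k].  For every subset [S] of [J], the array
    [A_S i = k - |i| + (i \in S)], truncated to [0, n], is a partition: a step
    along an axis lowers [k - |i|] by one, which pays for the extra unit that
    [S] may bring.  On [J] the truncation has no effect, so [A_S] determines [S]
    ([exp2_window_le]).  Hence there are at least [2 ^ #|J|] partitions.

    It remains to find a level at which [J] is large.  Now [i] lies in [J] exactly
    when some [t < n] satisfies [|i| + t = k], so [#|J|] is the size of the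
    level [k] of the coordinate sum on the grid with [d + 1] axes of length [n].
    This sum has variance [(d + 1)(n^2 - 1)/12] ([sum_weight_deviation]).  On
    the other hand an integer-valued variable none of whose values has
    probability above [m] satisfies [12 Var + 1 >= 1/m^2]
    ([spread_lower_bound]): replacing each atom by a uniform unit interval adds
    1/12 to the variance, and among the densities bounded by [m] the least
    spread one is the uniform density on an interval of length [1/m].  So, if no
    level has more than [W] points, then
    [n^(d+1) / W <= sqrt ((d + 1)(n^2 - 1) + 1) <= n sqrt (d + 1)], that is
    [W >= n^d / sqrt (d + 1)] ([window_bound_ge]).  This argument gives the
    theorem even with the constant 1 in place of 2/3. *)

Import Order.TTheory GRing.Theory Num.Theory.

Local Open Scope ring_scope.

(** * Partitions from subsets of a window of levels *)

Definition weight {d n : nat} (i : multi_index d n) : nat := (\sum_t i t)%N.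

Lemma weight_next {d n : nat} {t : 'I_d} {i j : multi_index d n} :
  next_along t i j -> weight j = (weight i).+1.
Proof.
case/andP=> /eqP jt /forallP js.
rewrite /weight (bigD1 t) //= [in RHS](bigD1 t) //= jt addSn.
congr (_ + _).+1%N; apply: eq_bigr => s st.
by move/(_ s)/implyP/(_ st)/eqP: js => ->.
Qed.

(** Here [k - weight i] lies in [0, n - 1], so that adding one to it is never
    truncated. *)
Definition window (d n k : nat) : {set multi_index d n} :=
  [set i | (weight i <= k < weight i + n)%N].

(** Truncation at 0 is that of natural subtraction; the unit is added before
    subtracting so that it has no effect above level [k]. *)
Definition staircase {d n} (k : nat) (S : {set multi_index d n}) :
    hypermatrix d n :=
  [ffun i => inord (minn n (k + (i \in S) - weight i))].

Lemma staircaseE {d n} (k : nat) (S : {set multi_index d n}) i :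
  staircase k S i = minn n (k + (i \in S) - weight i) :> nat.
Proof. by rewrite ffunE inordK // ltnS geq_minl. Qed.

Lemma staircase_partition (d n k : nat) (S : {set multi_index d n}) :
  is_partition (staircase k S).
Proof.
apply/forallP => t; apply/forallP => i; apply/forallP => j; apply/implyP.
move=> /weight_next wj; rewrite !staircaseE wj.
by case: (i \in S); case: (j \in S); lia.
Qed.

Lemma staircase_inj (d n k : nat) :
  {in powerset (window d n k) &, injective (@staircase d n k)}.
Proof.
move=> S S'; rewrite !inE => /fintype.subsetP SW /fintype.subsetP S'W eqA.
apply/setP => i; have [iW|iW] := boolP (i \in window d n k); last first.
  by rewrite (negbTE (contra (SW i) iW)) (negbTE (contra (S'W i) iW)).
have: staircase k S i = staircase k S' i :> nat by rewrite eqA.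
rewrite !staircaseE; move: iW; rewrite inE => /andP[].
by case: (i \in S); case: (i \in S') => //; lia.
Qed.

Lemma exp2_window_le (d n k : nat) : (2 ^ #|window d n k| <= num_partitions d n)%N.
Proof.
rewrite -[(2 ^ _)%N](card_powerset (window d n k)).
have <- : #|staircase k @: powerset (window d n k)| = #|powerset (window d n k)|.
  exact/card_in_imset/staircase_inj.
apply/subset_leq_card/fintype.subsetP => _ /imsetP[S _ ->].
by rewrite inE staircase_partition.
Qed.

(** The last coordinate [t = k - |i|] is determined by [i], so projecting it away
    embeds the level [k] of the grid with one more axis into the window. *)
Lemma card_fiber_le (d n k : nat) :
  (#|[set x : multi_index d n * 'I_n | weight x.1 + x.2 == k]|
     <= #|window d n k|)%N.
Proof.
set F := [set x | _].
have <- : #|fst @: F| = #|F|; last first.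
  apply/subset_leq_card/fintype.subsetP => _ /imsetP[[i t] + ->] /=.
  rewrite !inE /= => /eqP <-; have := ltn_ord t; lia.
apply: card_in_imset => -[i t] [j s] /=; rewrite !inE /= => /eqP <- /eqP eq_ij ij.
by rewrite -ij in eq_ij *; congr (_, _); apply/val_inj => /=; lia.
Qed.

(** * Bounded multiplicities force a large spread *)

Section Cubic.
Context {R : realFieldType} (a : R).
Hypothesis a_ge0 : 0 <= a.

(** An antiderivative of [z^2 - a^2], the weight whose integral against a density
    bounded by [m] is least when the density is [m] on [-a, a]. *)
Definition cubic (z : R) : R := z ^+ 3 / 3 - a ^+ 2 * z.

Definition clamp (z : R) : R := Num.max (- a) (Num.min a z).

Lemma clampP (z : R) :
  [\/ z <= - a /\ clamp z = - a, [/\ - a <= z, z <= a & clamp z = z]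
    | a <= z /\ clamp z = a].
Proof.
rewrite /clamp; case: (leP a z) => [az|za].
  by constructor 3; rewrite max_r; [split | have := a_ge0; lra].
case: (leP (- a) z) => zb; [constructor 2|constructor 1]; split=> //; lra.
Qed.

Lemma cubic_decr {x y} : - a <= x -> x <= y -> y <= a -> cubic y <= cubic x.
Proof.
move=> ax xy ya; rewrite -subr_ge0 /cubic.
have -> : x ^+ 3 / 3 - a ^+ 2 * x - (y ^+ 3 / 3 - a ^+ 2 * y) =
  (y - x) * ((a ^+ 2 - x ^+ 2) + (a ^+ 2 - y ^+ 2) + (a ^+ 2 - x * y)) / 3 by field.
rewrite divr_ge0 // mulr_ge0 ?subr_ge0 //.
have : 0 <= (a - x) * (a + x) by rewrite mulr_ge0; lra.
have : 0 <= (a - y) * (a + y) by rewrite mulr_ge0; lra.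
have := sqr_ge0 (x - y); nra.
Qed.

Lemma cubic_incr_ge {x y} : a <= x -> x <= y -> cubic x <= cubic y.
Proof.
move=> ax xy; rewrite -subr_ge0 /cubic.
have -> : y ^+ 3 / 3 - a ^+ 2 * y - (x ^+ 3 / 3 - a ^+ 2 * x) =
  (y - x) * ((x ^+ 2 - a ^+ 2) + (y ^+ 2 - a ^+ 2) + (x * y - a ^+ 2)) / 3 by field.
have ? := a_ge0; have sqr_ge u v : a <= u -> a <= v -> a ^+ 2 <= u * v.
  by move=> au av; rewrite expr2 ler_pM.
have ay := le_trans ax xy.
have ? := sqr_ge x x ax ax; have ? := sqr_ge y y ay ay.
have ? := sqr_ge x y ax ay.
by rewrite divr_ge0 // mulr_ge0 ?subr_ge0 //; lra.
Qed.

Lemma cubicN x : cubic (- x) = - cubic x.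
Proof. by rewrite /cubic; field. Qed.

Lemma cubic_incr_le {x y} : y <= - a -> x <= y -> cubic x <= cubic y.
Proof.
move=> ya xy; rewrite -lerN2 -!cubicN; apply: cubic_incr_ge; lra.
Qed.

Lemma clamp_bounds z : - a <= clamp z <= a.
Proof.
have ? := a_ge0; apply/andP.
by case: (clampP z) => [[? ->]|[? ? ->]|[? ->]]; split; lra.
Qed.

Lemma clamp_homo {x y} : x <= y -> clamp x <= clamp y.
Proof.
have ? := a_ge0; case: (clampP x) => [[? ->]|[? ? ->]|[? ->]];
  case: (clampP y) => [[? ->]|[? ? ->]|[? ->]]; lra.
Qed.

Lemma cubic_clamp_decr {x y} : x <= y -> cubic (clamp y) <= cubic (clamp x).
Proof.
move=> xy; have /andP[? _] := clamp_bounds x; have /andP[_ ?] := clamp_bounds y.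
by apply: cubic_decr => //; apply: clamp_homo.
Qed.

(** [cubic \o clamp] is the integral of the part of [z^2 - a^2] that lies below
    zero; what it leaves out is nonnegative. *)
Lemma cubic_clamp_le {x y} : x <= y ->
  cubic (clamp y) - cubic (clamp x) <= cubic y - cubic x.
Proof.
have ? := a_ge0; rewrite le_eqVlt => /predU1P[-> | xy]; first by rewrite !subrr.
have xy' := ltW xy.
case: (clampP x) => [[xa ->]|[xa xa' ->]|[ax ->]];
  case: (clampP y) => [[ya ->]|[ya ya' ->]|[ay ->]]; try lra.
- by have := cubic_incr_le ya xy'; lra.
- by have := cubic_incr_le (lexx _) xa; lra.
- by have := cubic_incr_le (lexx _) xa; have := cubic_incr_ge (lexx _) ay; lra.
- by have := cubic_incr_ge (lexx _) ay; lra.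
- by have := cubic_incr_ge ax xy'; lra.
Qed.

Lemma cubic_clamp_drop x y :
  - (4 / 3 * a ^+ 3) <= cubic (clamp y) - cubic (clamp x).
Proof.
have ? := a_ge0; have /andP[? ?] := clamp_bounds x.
have /andP[? ?] := clamp_bounds y.
have : cubic (clamp x) <= cubic (- a) by apply: cubic_decr.
have : cubic a <= cubic (clamp y) by apply: cubic_decr.
have : cubic a = - (2 / 3 * a ^+ 3) by rewrite /cubic; field.
by rewrite cubicN; lra.
Qed.

End Cubic.

(** Summing [(f x - c)^2 + 1/12 - a^2], the integral of [z^2 - a^2] over the unit
    interval centered at [f x - c], bounds the spread below: by
    [cubic_clamp_le] each term can be replaced by an increment of
    [cubic \o clamp], which is nonpositive, so that the worst case is when every
    value is taken [W] times, and then the increments telescope. *)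
Lemma spread_lower_bound {R : realFieldType} {I : finType} (f : I -> nat)
    (W : nat) (c : R) :
  (forall k, #|[set x | f x == k]| <= W)%N ->
  #|I|%:R ^+ 3 <= W%:R ^+ 2 * (12 * (\sum_x ((f x)%:R - c) ^+ 2) + #|I|%:R).
Proof.
move=> fW; set V := \sum_x _; set M := #|I|%:R.
have V_ge0 : 0 <= V by apply: sumr_ge0 => x _; apply: sqr_ge0.
have M_ge0 : 0 <= M by rewrite /M ler0n.
case: (posnP W) => [W0|W_gt0].
  have /eqP -> : M == 0.
    rewrite pnatr_eq0; apply/eqP/eq_card0 => x.
    have := fW (f x); rewrite W0 leqn0 cards_eq0 => /eqP/setP/(_ x).
    by rewrite !inE eqxx.
  by rewrite expr0n /= W0 expr0n mul0r.
have w_gt0 : 0 < W%:R :> R by rewrite ltr0n.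
(* The optimal [a]: a density [W / M] on [-a, a] has total mass 1. *)
pose a : R := M / (2 * W%:R).
have a_ge0 : 0 <= a by rewrite divr_ge0 // mulr_ge0 // ltW.
pose h k : R := cubic a (clamp a (k%:R - c - 2^-1)).
have h_decr k : h k.+1 - h k <= 0.
  by rewrite subr_le0 cubic_clamp_decr // -natr1; lra.
have h_le x : h (f x).+1 - h (f x) <= ((f x)%:R - c) ^+ 2 + 12^-1 - a ^+ 2.
  apply: (le_trans (cubic_clamp_le a a_ge0 _)); first by rewrite -natr1; lra.
  by rewrite -natr1 /cubic le_eqVlt; apply/orP; left; apply/eqP; field.
pose N := (\max_x f x).+1.
have fN x : (f x < N)%N by rewrite ltnS leq_bigmax.
have drop : - (4 / 3 * a ^+ 3) * W%:R <= \sum_x (h (f x).+1 - h (f x)).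
  rewrite (partition_big (fun x => Ordinal (fN x)) xpredT) //=.
  apply: (@le_trans _ _ (\sum_(k < N) (h k.+1 - h k) * W%:R)).
    rewrite -mulr_suml ler_pM2r // -(big_mkord xpredT (fun k => h k.+1 - h k)).
    by rewrite telescope_sumr // cubic_clamp_drop.
  apply: ler_sum => k _.
  rewrite (eq_bigr (fun=> h k.+1 - h k)); last by move=> x /eqP <-.
  rewrite sumr_const -[leRHS]mulr_natr; apply: ler_wnM2l; first exact: h_decr.
  rewrite ler_nat (leq_trans _ (fW k)) // subset_leq_card //.
  by apply/fintype.subsetP => x; rewrite !inE => /eqP <- /=.
have : - (4 / 3 * a ^+ 3) * W%:R <= V + M / 12 - M * a ^+ 2.
  apply: (le_trans drop).
  apply: le_trans (ler_sum _ (fun x _ => h_le x)) _.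
  rewrite big_split big_split /= !sumr_const -/V.
  rewrite -[12^-1 *+ _]mulr_natl -[_ *+ #|I|]mulr_natl -/M.
  lra.
have -> : - (4 / 3 * a ^+ 3) * W%:R = M ^+ 3 / (12 * W%:R ^+ 2) - M * a ^+ 2.
  by rewrite /a; field; lra.
rewrite lerD2r ler_pdivrMr; last by rewrite mulr_gt0 ?exprn_gt0.
lra.
Qed.

(** * The variance of the coordinate sum *)

Lemma sum_centered_sqr (R : numFieldType) (n : nat) (c : R) :
  \sum_(t < n) (t%:R - c) ^+ 2 =
  n%:R * (n%:R - 1) * (2 * n%:R - 1) / 6 - c * n%:R * (n%:R - 1) + n%:R * c ^+ 2.
Proof.
elim: n => [|n IHn]; first by rewrite big_ord0; field.
by rewrite big_ord_recr /= IHn -natr1; field.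
Qed.

Lemma sum_centered (R : numFieldType) (n : nat) (c : R) :
  \sum_(t < n) (t%:R - c) = n%:R * (n%:R - 1) / 2 - n%:R * c.
Proof.
elim: n => [|n IHn]; first by rewrite big_ord0; field.
by rewrite big_ord_recr /= IHn -natr1; field.
Qed.

(** The coordinates of a uniformly random function are independent, so centered
    variables attached to two distinct coordinates are uncorrelated.  The
    factor [#|T|] avoids the exponent [#|I| - 1]. *)
Lemma sum_ffun_mul {R : comNzRingType} {I T : finType} (u : T -> R) (i j : I) :
  \sum_t u t = 0 ->
  #|T|%:R * (\sum_(x : {ffun I -> T}) u (x i) * u (x j)) =
  (if j == i then #|T|%:R ^+ #|I| * \sum_t u t ^+ 2 else 0).
Proof.
move=> u0.
(* Factors equal to 1 make the summand a product over all the coordinates, so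
   that the sum distributes. *)
pose g l t := (if l == i then u t else 1) * (if l == j then u t else 1).
have -> : \sum_(x : {ffun I -> T}) u (x i) * u (x j) = \prod_l \sum_t g l t.
  rewrite bigA_distr_bigA; apply: eq_bigr => x _.
  by rewrite big_split /= -!big_mkcond !big_pred1_eq.
rewrite (bigD1 i) //= /g eqxx; case: (eqVneq j i) => [->|ij].
  rewrite [\prod_(l | _) _](eq_bigr (fun=> #|T|%:R)) => [|l li]; last first.
    by rewrite (negbTE li) (eq_bigr (fun=> 1)) ?sumr_const // => t _; rewrite mulr1.
  have cardI : #|I| = #|predC1 i|.+1.
    by rewrite cardC1 prednK //; apply/card_gt0P; exists i.
  rewrite prodr_const cardI exprS -mulrA [X in _ * X]mulrC.
  by under eq_bigr do rewrite -expr2.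
by under eq_bigr do rewrite mulr1; rewrite u0 mul0r mulr0.
Qed.

Lemma second_moment_ffun {R : comNzRingType} {I T : finType} (u : T -> R) :
  \sum_t u t = 0 ->
  #|T|%:R * (\sum_(x : {ffun I -> T}) (\sum_i u (x i)) ^+ 2) =
  #|I|%:R * #|T|%:R ^+ #|I| * \sum_t u t ^+ 2.
Proof.
move=> u0; under eq_bigr do rewrite expr2 big_distrlr /=.
rewrite exchange_big /= mulr_sumr.
rewrite (eq_bigr (fun=> #|T|%:R ^+ #|I| * \sum_t u t ^+ 2)).
  by rewrite sumr_const -mulrA -[LHS]mulr_natl.
move=> i _; rewrite exchange_big /= [LHS]mulr_sumr.
rewrite (eq_bigr _ (fun j _ => sum_ffun_mul u i j u0)).
by rewrite -big_mkcond big_pred1_eq.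
Qed.


Lemma sum_shift_sqr {R : comNzRingType} {T : finType} (u : T -> R) (s : R) :
  \sum_t u t = 0 ->
  \sum_t (s + u t) ^+ 2 = #|T|%:R * s ^+ 2 + \sum_t u t ^+ 2.
Proof.
move=> u0; under eq_bigr do rewrite sqrrD.
rewrite big_split big_split /= sumr_const sumrMnl -mulr_sumr u0 mulr0 mul0rn addr0.
by rewrite -[_ *+ #|T|]mulr_natl.
Qed.

Lemma sum_weight_deviation (R : numFieldType) (d n : nat) :
  \sum_(x : multi_index d n * 'I_n)
    ((weight x.1 + x.2)%:R - (d%:R + 1) * (n%:R - 1) / 2) ^+ 2 =
  n%:R ^+ d.+1 * ((d%:R + 1) * (n%:R ^+ 2 - 1) / 12) :> R.
Proof.
pose u (t : 'I_n) : R := t%:R - (n%:R - 1) / 2.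
have u0 : \sum_t u t = 0 by rewrite sum_centered; field.
have u2 : \sum_t u t ^+ 2 = n%:R * (n%:R ^+ 2 - 1) / 12.
  by rewrite sum_centered_sqr; field.
pose s (i : multi_index d n) := \sum_t u (i t).
rewrite (eq_bigr (fun x => (s x.1 + u x.2) ^+ 2)); last first.
  move=> x _; congr (_ ^+ 2); rewrite natrD /s /weight natr_sum /u sumrB.
  by rewrite sumr_const card_ord -mulr_natl; field.
rewrite -(pair_bigA _ (fun i t => (s i + u t) ^+ 2)) /=.
rewrite (eq_bigr _ (fun i _ => sum_shift_sqr u (s i) u0)) big_split /=.
rewrite -mulr_sumr card_ord -[n in n%:R * _]card_ord (second_moment_ffun u u0).
rewrite sumr_const card_ffun !card_ord u2 -[_ *+ (n ^ d)%N]mulr_natl natrX.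
by rewrite (exprS _ d); field.
Qed.

(** * The bound *)

Lemma window_bound_ge (R : realFieldType) {d n W : nat} : (0 < n)%N ->
  (forall k, #|window d n k| <= W)%N ->
  (n%:R ^+ d) ^+ 2 <= W%:R ^+ 2 * (d%:R + 1) :> R.
Proof.
move=> n_gt0 winW; pose N : R := n%:R; pose D : R := d%:R + 1.
have N_gt0 : 0 < N by rewrite ltr0n.
have Nd_gt0 : 0 < N ^+ d by rewrite exprn_gt0.
have fibW k := leq_trans (card_fiber_le d n k) (winW k).
have := spread_lower_bound _ _ (D * (N - 1) / 2) fibW.
rewrite sum_weight_deviation card_prod card_ffun !card_ord natrM natrX.
rewrite -/N -/D.
have -> : W%:R ^+ 2 * (12 * (N ^+ d.+1 * (D * (N ^+ 2 - 1) / 12)) + N ^+ d * N) =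
    (W%:R ^+ 2 * (D * (N ^+ 2 - 1) + 1)) * (N ^+ d * N).
  by rewrite (exprS _ d); field.
rewrite (exprSr _ 2) ler_pM2r ?mulr_gt0 // => large.
rewrite -(ler_pM2r (exprn_gt0 2 N_gt0)) -exprMn (le_trans large) //.
(* Here [D * (N^2 - 1) + 1 <= D * N^2] because [1 <= D]. *)
rewrite -[leRHS]mulrA ler_wpM2l ?sqr_ge0 // mulrBr mulr1.
by rewrite -addrA gerDl addrC subr_le0 lerDr ler0n.
Qed.

Theorem theorem2 (R : realType) (d n : nat) (hd : (1 <= d)%N) (hn : (1 <= n)%N) :
  (2 : R) `^ (2 / 3 * (n%:R ^+ d / Num.sqrt (d%:R + 1))) <= (num_partitions d n)%:R.
Proof.
set P := num_partitions d n.
have P_gt0 : (0 < P)%N.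
  by apply: leq_trans (exp2_window_le d n 0); rewrite expn_gt0.
(* A bound on all the windows at once, with [2 ^ W <= P] by definition: no
   largest window has to be singled out. *)
pose W := trunc_log 2 P.
have winW k : (#|window d n k| <= W)%N.
  by rewrite trunc_log_max // exp2_window_le.
have W_large := window_bound_ge R hn winW.
pose N : R := n%:R; pose D : R := d%:R + 1.
have N_gt0 : 0 < N by rewrite ltr0n.
have D_gt0 : 0 < D by rewrite ltr_wpDl // ler0n.
have sqrtD_gt0 : 0 < Num.sqrt D by rewrite sqrtr_gt0.
have Nd_ge0 : 0 <= N ^+ d by rewrite exprn_ge0 // ltW.
have W_root : N ^+ d / Num.sqrt D <= W%:R.
  have WD_ge0 : 0 <= W%:R * Num.sqrt D by rewrite mulr_ge0 // ltW.
  rewrite ler_pdivrMr // -(ler_sqr Nd_ge0 WD_ge0) exprMn sqr_sqrtr //.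
  exact: ltW.
have q_ge0 : 0 <= N ^+ d / Num.sqrt D by rewrite divr_ge0 // ltW.
apply: (@le_trans _ _ (2 `^ W%:R)).
  by rewrite ler_powR ?ler1n // -/N -/D; lra.
by rewrite powR_mulrn // -natrX ler_nat trunc_logP.
Qed.
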